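(* Let $p>2$ be a prime number and let $G\neq\{e\}$ be a finite $p$-group. Then there exists a characteristic subgroup $N$ of $G$ such that: (1) $\log_2|G:N|\leq (b(G)+2)\,f^{b(G)+1}(b(G)\log_2 p)$, where $f^k$ denotes the $k$-th iterate of the function $f(x)=x(x+1)$; (2) $cl(N)\leq b(N)+1$.
   Context: For a finite $p$-group $K$ and $x\in K$, $b(x)=\log_p|K:Z_K(x)|$ where $Z_K(x)$ is the centralizer of $x$ in $K$, and $b(K):=\max_{x\in K}b(x)$ (so $b(N)$ is the breadth of $N$ as a group in its own right). $cl(N)$ denotes the nilpotency class of $N$. *)

(* Defs.v *)
From Stdlib Require Import Reals.
From mathcomp Require Import all_boot all_fingroup all_solvable.
Set Implicit Arguments. Unset Strict Implicit. Unset Printing Implicit Defensive.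

Definition breadth_elt (p : nat) (gT : finGroupType) (K : {group gT}) (x : gT) : nat :=
  logn p #|K : 'C_K[x]|%g.

Definition breadth (p : nat) (gT : finGroupType) (K : {group gT}) : nat :=
  \max_(x in K) breadth_elt p K x.

Definition log2 (x : R) : R := Rdiv (ln x) (ln 2).

Definition f_iter_base (x : R) : R := Rmult x (Rplus x 1).

Definition f_iter (k : nat) (x : R) : R := Nat.iter k f_iter_base x.

(* Main.v *)
Require Import Defs.
From Stdlib Require Import Reals Lra.
From mathcomp Require Import all_boot all_fingroup all_solvable.

(** Let [b = b(G)]. The subgroup [N = 'C_G(G^`(1))] has class at most 2, which is
    at most [b(N) + 1] unless [N] is abelian, so only its index is at stake.
    Choose [a] with [b(a) = b] and [b] elements [S] such that
    [G = 'C_G[a] * <<S>>]. By a conjugacy class count (B. H. Neumann), all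
    commutators of [U = 'C_G(S)] with [G] lie in the normal closure of [a].
    As [U] has index at most [p^(b^2)], we have [G = U * <<T>>] with
    [#|T| <= b^2]; then [<<a |: S :|: T>>] is normal with abelian quotient, so
    it contains [G^`(1)], and its centralizer has index at most
    [p^(b * (1 + b + b^2))]. *)

(** * Breadth, indices of centralizers and the derived subgroup *)

Section Breadth.

Set Implicit Arguments. Unset Strict Implicit. Unset Printing Implicit Defensive.

Variables (p : nat) (gT : finGroupType).
Implicit Types (G U H A B : {group gT}) (S : {set gT}).
Hypothesis p_pr : prime p.

Local Open Scope group_scope.

(** Induction on [#|G|]: a proper [U] lies in a maximal subgroup [M], which is normal of index [p].
    One element outside [M], added to the elements found for [M], restores [G] and uses up exactly
    one factor [p] of the index. *)
Lemma pgroup_supplement_gens G U :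
  p.-group G -> U \subset G ->
  exists S, [/\ S \subset G, #|S| <= logn p #|G : U| & U * <<S>> = G].
Proof.
have [n] := ubnP #|G|; elim: n G => // n IHn G leGn pG sUG.
have [-> | [M maxM sUM]] := maximal_exists sUG.
  by exists set0; rewrite sub0set cards0 gen0 mulg1.
have nsMG := p_maximal_normal pG maxM; have sMG := normal_sub nsMG.
have prMG : M \proper G := maxgroupp maxM.
have [|S [sSM leS defM]] := IHn M _ (pgroupS sMG pG) sUM.
  by rewrite -ltnS (leq_trans _ leGn) // ltnS proper_card.
have [_ [y Gy My]] := properP prMG.
have sySG : y |: S \subset G by rewrite subUset sub1set Gy (subset_trans sSM).
exists (y |: S); split=> //.
  rewrite (leq_trans (leq_card_setU _ _)) // cards1.
  rewrite -(Lagrange_index sMG sUM) lognM ?indexg_gt0 //.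
  by rewrite (p_maximal_index pG maxM) (logn_prime _ p_pr) eqxx leq_add2l.
apply/eqP; rewrite eqEsubset mul_subG ?gen_subG //=.
have <- : M * <[y]> = G.
  by apply: mulg_normal_maximal => //; rewrite cycle_subG.
by rewrite -defM -mulgA mulgS // mul_subG // gen_subG -?sub1set ?subset_gen
  // sub_gen // ?subsetUl ?subsetUr.
Qed.

(** The product set of [G :&: A] and [G :&: B] lies in [G], and its size is the product of their
    orders divided by the order of their intersection. *)
Lemma leq_indexI G A B : #|G : A :&: B| <= (#|G : A| * #|G : B|)%N.
Proof.
have eqA := LagrangeI G A; have eqB := LagrangeI G B.
have := mul_cardG (G :&: A) (G :&: B); rewrite /= -setIIr => eqAB.
have eqI := LagrangeI G (A :&: B).
have leG : #|(G :&: A) * (G :&: B)| <= #|G|.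
  by rewrite subset_leq_card // mul_subG ?subsetIl.
rewrite -(leq_pmul2l (cardG_gt0 (G :&: (A :&: B)%G))) /= eqI.
rewrite -(leq_pmul2l (cardG_gt0 G)) -{1}eqA -{1}eqB mulnACA eqAB.
by rewrite -!mulnA leq_mul2r leG orbT.
Qed.

Lemma index_cent_leq k G S :
  (forall x, x \in S -> #|G : 'C[x]| <= k) -> #|G : 'C(S)| <= (k ^ #|S|)%N.
Proof.
have [n] := ubnP #|S|; elim: n S => // n IHn S leSn kS.
have [-> | [x Sx]] := set_0Vmem S.
  by rewrite -cent_gen gen0 cent1T -indexgI setIT indexgg cards0.
rewrite -(setD1K Sx) centU cent_set1 cardsU1 !inE eqxx add1n expnS.
apply: leq_trans (leq_indexI G 'C[x] 'C(S :\ x)) _.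
apply: leq_mul; first exact: kS.
apply: IHn => [|y]; last by rewrite inE => /andP[_ /kS].
by move: leSn; rewrite (cardsD1 x S) Sx.
Qed.

Lemma index_cent1_leq_breadth G x :
  p.-group G -> x \in G -> #|G : 'C[x]| <= (p ^ breadth p G)%N.
Proof.
move=> pG Gx; rewrite -indexgI.
have /part_pnat_id <-: p.-nat #|G : 'C_G[x]| := pnat_dvd (dvdn_indexg _ _) pG.
rewrite p_part leq_exp2l ?prime_gt1 //.
by rewrite (leq_bigmax_cond (F := breadth_elt p G)).
Qed.

Lemma breadth_attained G : {a | a \in G & breadth p G = breadth_elt p G a}.
Proof. by apply: eq_bigmax_cond; rewrite cardG_gt0. Qed.

(* If [b(a)] is maximal and the conjugates of [a] are taken by elements of [H],
   then for [u] centralizing [H] the conjugates of [u * a] include, hence equal,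
   the elements of [u *: (a ^: G)]. *)
Lemma commg_max_breadth G H a u y :
  p.-group G -> a \in G -> breadth p G = breadth_elt p G a ->
  H \subset G -> 'C_G[a] * H = G -> u \in 'C_G(H) -> y \in G ->
  [~ u, y] \in <<a ^: G>>.
Proof.
move=> pG Ga maxa sHG defG /setIP[Gu cHu] Gy.
have conjH z : z \in a ^: G -> exists2 h, h \in H & z = a ^ h.
  case/imsetP=> g; rewrite -defG => /mulsgP[c h /setIP[_ /cent1P cac] Hh ->] ->.
  by exists h; rewrite // conjgM [a ^ c]conjgE -cac mulKg.
have sub: u *: (a ^: G) \subset (u * a) ^: G.
  apply/subsetP=> _ /lcosetP[_ /conjH[h Hh ->] ->].
  have -> : u * a ^ h = (u * a) ^ h.
    by rewrite conjMg [u ^ h]conjgE (centP cHu h Hh) mulKg.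
  by rewrite memJ_class // (subsetP sHG).
(* By the choice of [a], the left side already has [p ^ breadth p G] elements, the largest possible
   size of a class. *)
have eqC: u *: (a ^: G) = (u * a) ^: G.
  apply/eqP; rewrite eqEcard sub card_lcoset -!index_cent1 indexgI.
  apply: leq_trans (index_cent1_leq_breadth pG (groupM Gu Ga)) _.
  rewrite maxa -p_part part_pnat_id //; exact: pnat_dvd (dvdn_indexg _ _) pG.
have /lcosetP[z Cz def] : (u * a) ^ y \in u *: (a ^: G).
  by rewrite eqC memJ_class.
(* From [(u * a) ^ y = u * z], the commutator is a quotient of two conjugates of [a]. *)
have -> : [~ u, y] = z * (a ^ y)^-1.
  apply: (mulIg (a ^ y)); rewrite mulgKV commgEl -mulgA -conjMg def mulKg //.
by rewrite groupM ?groupV ?mem_gen ?memJ_class.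
Qed.

Lemma der1_sub_gens G :
  p.-group G ->
  exists S, [/\ S \subset G, G^`(1) \subset <<S>>
    & #|S| <= (1 + breadth p G + breadth p G * breadth p G)%N].
Proof.
move=> pG; set b := breadth p G.
have [a Ga maxa] := breadth_attained G.
have [S [sSG leS defG]] := pgroup_supplement_gens pG (subsetIl G 'C[a]).
have sHG: <<S>> \subset G by rewrite gen_subG.
have [T [sTG leT defGT]] := pgroup_supplement_gens pG (subsetIl G 'C(S)).
pose Z := a |: (S :|: T); exists Z.
have leSb : #|S| <= b by rewrite /b maxa.
have iU : #|G : 'C(S)| <= (p ^ (b * b))%N.
  apply: leq_trans (index_cent_leq (k := (p ^ b)%N) _) _.
    by move=> x /(subsetP sSG); apply: index_cent1_leq_breadth.
  by rewrite -expnM leq_exp2l ?prime_gt1 // leq_mul2l leSb orbT.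
split.
- by rewrite !subUset sub1set Ga sSG.
- have sSZ: <<S>> \subset <<Z>> by rewrite genS // /Z setUCA subsetUl.
  have sTZ: <<T>> \subset <<Z>> by rewrite genS // /Z setUA subsetUr.
  (* As [G = 'C_G[a] * <<S>>], every conjugate of [a] is obtained by an element of [<<S>>]. *)
  have sAZ: <<a ^: G>> \subset <<Z>>.
    rewrite gen_subG; apply/subsetP=> _ /imsetP[g Gg ->].
    move: Gg; rewrite -defG => /mulsgP[c h /setIP[_ /cent1P cac] Hh ->].
    have Za : a \in <<Z>> by rewrite mem_gen ?setU11.
    by rewrite conjgM [a ^ c]conjgE -cac mulKg groupJ // (subsetP sSZ).
  have sUG_Z: [~: 'C_G(S), G] \subset <<Z>>.
    apply: subset_trans sAZ; rewrite gen_subG.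
    apply/subsetP=> _ /imset2P[u y Uu Gy ->].
    by apply: commg_max_breadth maxa sHG defG _ Gy; rewrite ?cent_gen.
  have nZU: 'C_G(S) \subset 'N(<<Z>>).
    rewrite -commg_subr (subset_trans _ sUG_Z) // commgS // gen_subG.
    by rewrite !subUset sub1set Ga sSG.
  (* Both factors of [G = 'C_G(S) * <<T>>] normalize [<<Z>>], the second being contained in it. *)
  have nZG: G \subset 'N(<<Z>>).
    by rewrite -defGT mul_subG // (subset_trans sTZ) ?normG.
  apply: der1_min => //.
  (* The factor [<<T>>] dies in the quotient, and the image of ['C_G(S)] is abelian by [sUG_Z]. *)
  have -> : G / <<Z>> = 'C_G(S) / <<Z>>.
    by rewrite -{1}defGT quotientMl // (quotientS1 sTZ) mulg1.
  rewrite /abelian quotient_cents2 // (subset_trans _ sUG_Z) // commgS //.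
  exact: subsetIl.
rewrite -addnA (leq_trans (leq_card_setU _ _)) // cards1 leq_add2l.
rewrite (leq_trans (leq_card_setU _ _)) // leq_add //.
apply: leq_trans leT _; rewrite indexgI -(leq_exp2l _ _ (prime_gt1 p_pr)).
by apply: leq_trans iU; rewrite -p_part dvdn_leq ?dvdn_part.
Qed.

Lemma index_cent_der1_leq G :
  p.-group G ->
  #|G : 'C_G(G^`(1))|
    <= (p ^ (breadth p G * (1 + breadth p G + breadth p G * breadth p G)))%N.
Proof.
move=> pG; set b := breadth p G; have [S [sSG sDS leS]] := der1_sub_gens pG.
rewrite indexgI; apply: (@leq_trans #|G : 'C(S)|).
  apply: dvdn_leq (indexg_gt0 _ _) _; apply: indexgS.
  by rewrite /= -(cent_gen S) centS.
apply: leq_trans (index_cent_leq (k := (p ^ b)%N) _) _.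
  by move=> x /(subsetP sSG); apply: index_cent1_leq_breadth.
by rewrite -expnM leq_exp2l ?prime_gt1 // leq_mul2l leS orbT.
Qed.

Lemma nil_class_cent_der1 G : nil_class 'C_G(G^`(1)) <= 2.
Proof.
rewrite nil_class2 subsetI der_sub /= (subset_trans (dergS 1 (subsetIl _ _))) //.
by rewrite centsC subsetIr.
Qed.

Lemma breadth_eq0_abelian G : p.-group G -> breadth p G = 0 -> abelian G.
Proof.
move=> pG b0; apply/subsetP=> x Gx; apply/centP=> y Gy.
have := index_cent1_leq_breadth pG Gx; rewrite b0 expn0.
rewrite -indexgI leq_eqVlt ltnS leqn0 eqn0Ngt indexg_gt0 orbF.
by rewrite indexg_eq1 subsetI subxx /= => /subsetP/(_ y Gy)/cent1P.
Qed.

End Breadth.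

(** * Real estimates for logarithms and iterates of [f_iter_base] *)

Section RealBounds.

Set Implicit Arguments. Unset Strict Implicit. Unset Printing Implicit Defensive.

Local Open Scope R_scope.

Lemma f_iter_ge (k : nat) (x : R) : 0 <= x -> x <= f_iter k x.
Proof.
move=> x0; elim: k => [|k IHk]; first exact: Rle_refl.
by rewrite /f_iter /= -/(f_iter k x) /f_iter_base; nra.
Qed.

Lemma f_iterSr (k : nat) (x : R) : f_iter k.+1 x = f_iter k (f_iter_base x).
Proof. by rewrite /f_iter Nat.iter_succ_r. Qed.

(** Two iterations already suffice, giving [x * (x + 1) * (x * (x + 1) + 1)]; the remaining ones
    cannot decrease the value. *)
Lemma f_iter2_ge (k : nat) (x b : R) :
  1 <= b <= x -> x * (1 + b + b * b) <= f_iter k.+2 x.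
Proof.
move=> [b1 bx].
have: f_iter_base (f_iter_base x) <= f_iter k.+2 x.
  by rewrite !f_iterSr; apply: f_iter_ge; rewrite /f_iter_base; nra.
apply: Rle_trans; rewrite /f_iter_base.
have : b * b <= x * x by nra.
have : 1 + b + b * b <= (x + 1) * (x * (x + 1) + 1) by nra.
nra.
Qed.

Lemma ln_le (x y : R) : 0 < x -> x <= y -> ln x <= ln y.
Proof.
by move=> x0 [/(ln_increasing _ _ x0)/Rlt_le | ->] //; apply: Rle_refl.
Qed.

Lemma log2_le_pow (p n k : nat) : (1 < p)%N -> (0 < n)%N -> (n <= p ^ k)%N ->
  log2 (INR n) <= INR k * log2 (INR p).
Proof.
move=> p1 n0 lenk.
have ln2 : 0 < ln 2 by rewrite -ln_1; apply: ln_increasing; lra.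
have Rp : 0 < INR p by apply: lt_0_INR; apply/ltP; apply: ltnW.
rewrite /log2 /Rdiv -Rmult_assoc -ln_pow //; apply: Rmult_le_compat_r.
  by apply/Rlt_le/Rinv_0_lt_compat.
apply: ln_le; first by apply: lt_0_INR; apply/ltP.
rewrite -pow_INR; apply: le_INR; apply/leP.
suff -> : Nat.pow p k = (p ^ k)%N by [].
by elim: k {lenk} => //= k ->; rewrite expnS.
Qed.

Lemma log2_ge1 (p : nat) : (1 < p)%N -> 1 <= log2 (INR p).
Proof.
move=> p1; have ln2 : 0 < ln 2 by rewrite -ln_1; apply: ln_increasing; lra.
apply: (Rmult_le_reg_r (ln 2)) => //.
rewrite /log2 /Rdiv Rmult_assoc Rinv_l; last lra.
rewrite Rmult_1_l Rmult_1_r; apply: ln_le; first lra.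
by apply: (le_INR 2); apply/leP.
Qed.

Lemma f_iter_dominates (b p : nat) : (1 < p)%N ->
  INR (b * (1 + b + b * b))%N * log2 (INR p)
    <= (INR b + 2) * f_iter b.+1 (INR b * log2 (INR p)).
Proof.
move=> /log2_ge1; set L := log2 _ => L1.
(* For [b = 0] both sides vanish. Otherwise at least two iterations are available, starting from
   [B * L >= B], and the factor [B + 2] is only used as being at least 1. *)
case: b => [|b]; first by rewrite mul0n /= !Rmult_0_l /f_iter_base; lra.
rewrite -multE -plusE !(mult_INR, plus_INR) [INR 1]/=.
set B := INR b.+1.
have B1 : 1 <= B by apply: (le_INR 1); apply/leP.
have BL : 1 <= B <= B * L by nra.
have leF := f_iter2_ge b BL.
have F0 : 0 <= f_iter b.+2 (B * L) by apply: Rle_trans leF; nra.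
have -> : B * (1 + B + B * B) * L = B * L * (1 + B + B * B) by ring.
apply: Rle_trans leF _; nra.
Qed.

End RealBounds.

Theorem theorem5 (p : nat) (gT : finGroupType) (G : {group gT}) :
  prime p -> 2 < p -> (p.-group G)%g -> (G :!=: 1)%g ->
  exists N : {group gT},
    (N \char G)%g /\
    Rle (log2 (INR #|G : N|%g))
        (Rmult (Rplus (INR (breadth p G)) 2)
               (f_iter (breadth p G).+1
                       (Rmult (INR (breadth p G)) (log2 (INR p))))) /\
    nil_class N <= (breadth p N).+1.
Proof.
move=> p_pr p_gt2 pG _; exists 'C_G(G^`(1))%G; split; last split.
- by rewrite subcent_char ?char_refl ?der_char.
- have p1 := prime_gt1 p_pr.
  apply: Rle_trans (f_iter_dominates (breadth p G) p1).
  exact: log2_le_pow p1 (indexg_gt0 _ _) (index_cent_der1_leq p_pr pG).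
- have pN : (p.-group 'C_G(G^`(1)))%g := pgroupS (subsetIl _ _) pG.
  case: (posnP (breadth p 'C_G(G^`(1))%G)) => [b0 | b_gt0].
    by rewrite b0 nil_class1 (breadth_eq0_abelian p_pr pN b0).
  exact: leq_trans (nil_class_cent_der1 G) _.
Qed.
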